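(* For any finite field $\mathbb F_{p^m}$ ($p$ prime, $m\ge 1$), the semigroup $LCAT(\mathbb F_{p^m}^{\mathbb N})$ is ID.
   Context: $\mathbb N$ includes $0$. $\mathbb F_{p^m}$ is the field with $p^m$ elements (discrete topology), and $\mathbb F_{p^m}^{\mathbb N}$ is the space of one-sided sequences $a=a_0a_1a_2\dots$ over it, with the product topology and its coordinatewise $\mathbb F_{p^m}$-vector space structure. $\sigma$ is the left shift, $\sigma(a)_k=a_{k+1}$. $CAT(\mathbb F_{p^m}^{\mathbb N})$ is the set of all continuous maps $\tau:\mathbb F_{p^m}^{\mathbb N}\to\mathbb F_{p^m}^{\mathbb N}$ with $\tau\sigma=\sigma\tau$, and $LCAT(\mathbb F_{p^m}^{\mathbb N})$ is the semigroup (under composition) of those elements of $CAT(\mathbb F_{p^m}^{\mathbb N})$ that are $\mathbb F_{p^m}$-linear. A semigroup $\Sigma$ of such transformations is ID if every closed $\Sigma$-invariant proper subset of $\mathbb F_{p^m}^{\mathbb N}$ is finite; a set $A$ is $\Sigma$-invariant if $\tau(A)\subset A$ for all $\tau\in\Sigma$. *)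

(* Defs.v *)
From HB Require Import structures.
From mathcomp Require Import all_boot all_order all_algebra.
From mathcomp Require Import boolp classical_sets functions cardinality.
From mathcomp Require Import topology.

Set Implicit Arguments.
Unset Strict Implicit.
Unset Printing Implicit Defensive.

Import GRing.Theory.

Local Open Scope classical_set_scope.
Local Open Scope ring_scope.

(* [F^o] is [F] as a module over itself; both types below are convertible to
   [nat -> F]. The first carries the product of the discrete topologies, the
   second the coordinatewise [F]-vector space structure. *)
Definition sequences (F : finFieldType) : topologicalType :=
  prod_topology (fun _ : nat => discrete_topology F).

Definition lsequences (F : finFieldType) : lmodType F := nat -> F^o.

Definition shift (F : finFieldType) (a : sequences F) : sequences F :=
  fun k => a k.+1.

Definition CAT (F : finFieldType) : set (sequences F -> sequences F) :=
  [set tau : sequences F -> sequences F |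
    continuous tau /\ tau \o @shift F = @shift F \o tau].

Record transf_semigroup (F : finFieldType) := TransfSemigroup {
  transformations : set (sequences F -> sequences F);
  transformations_CAT : transformations `<=` @CAT F;
  transformations_comp : forall tau1 tau2,
    transformations tau1 -> transformations tau2 ->
    transformations (tau1 \o tau2)
}.

Definition LCAT_set (F : finFieldType) : set (sequences F -> sequences F) :=
  [set tau : sequences F -> sequences F |
    CAT tau /\ linear (tau : lsequences F -> lsequences F)].

Lemma LCAT_subset (F : finFieldType) : @LCAT_set F `<=` @CAT F.
Proof. by move=> tau []. Qed.

Lemma LCAT_comp (F : finFieldType) (tau1 tau2 : sequences F -> sequences F) :
  LCAT_set tau1 -> LCAT_set tau2 -> LCAT_set (tau1 \o tau2).
Proof.
move=> [[cont1 comm1] lin1] [[cont2 comm2] lin2]; split; last first.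
  by move=> c a b; rewrite /= lin2 lin1.
split; first by move=> a; apply: continuous_comp; [exact: cont2|exact: cont1].
by rewrite -compA comm2 compA comm1.
Qed.

Definition LCAT (F : finFieldType) : transf_semigroup F :=
  TransfSemigroup (@LCAT_subset F) (@LCAT_comp F).

Definition invariant_set (F : finFieldType) (S : transf_semigroup F)
    (A : set (sequences F)) : Prop :=
  forall tau, transformations S tau -> tau @` A `<=` A.

Definition is_ID (F : finFieldType) (S : transf_semigroup F) : Prop :=
  forall A : set (sequences F),
    closed A -> invariant_set S A -> A `<` [set: sequences F] -> finite_set A.

(* Main.v *)
Require Import Defs.
From mathcomp Require Import all_boot all_algebra.
From mathcomp Require Import boolp classical_sets cardinality filter topology.

(** Continuous linear maps commuting with the shift include all the finite
    combinations of iterates of the shift.  Let [A] be closed and invariant, and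
    fix [n].  If every point of [A] satisfies a nonzero linear recurrence with
    [n] coefficients, then [A] is finite, because there are finitely many
    recurrences and a solution is determined by its first [n] terms.  Otherwise
    some [a] in [A] satisfies no such recurrence, that is, the Hankel matrix of
    [a] with [n] columns and enough rows has rank [n]; hence every word of
    length [n] is the beginning of a combination of shifts of [a], a point
    of [A].  If this happens for all [n], then [A] is dense. *)

Set Implicit Arguments.
Unset Strict Implicit.
Unset Printing Implicit Defensive.

Import GRing.Theory.

Local Open Scope classical_set_scope.
Local Open Scope ring_scope.

Section SequenceTopology.
Variable F : finFieldType.

(** The product topology is the supremum of the topologies pulled back along the coordinates, and
    each factor is discrete. *)
Lemma cvg_sequences (T : Type) (G : set_system T) {FG : Filter G}
    (f : T -> sequences F) (l : sequences F) :
  (forall k, \forall t \near G, f t k = l k) -> f @ G --> l.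
Proof.
move=> fl; apply/cvg_sup => k U [/= V [[W oW <-] Wl]] sWU.
by apply: filterS (fl k) => t ftk; apply: sWU; rewrite /= ftk.
Qed.

Lemma near_coord (a : sequences F) (k : nat) :
  \forall b \near a, b k = a k.
Proof.
exact: (@proj_continuous _ (fun=> discrete_topology F) k a _
  (discrete_set1 (a k))).
Qed.

Lemma closed_prefix (A : set (sequences F)) (b : sequences F) :
  closed A ->
  (forall n, exists2 a, A a & forall k, (k < n)%N -> a k = b k) -> A b.
Proof.
move=> clA prefA.
have /choice [f fP] : forall n, exists a, A a /\ forall k, (k < n)%N -> a k = b k.
  by move=> n; have [a Aa ab] := prefA n; exists a.
apply: (closed_cvg A clA (u_ := f) (F := \oo)).
  by apply: nearW => n; have [] := fP n.
apply: cvg_sequences => k; near=> n.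
have [_] := fP n; apply.
by near: n; exact: nbhs_infty_gt.
Unshelve. all: by end_near. Qed.

End SequenceTopology.

Section ShiftCombinations.
Variable F : finFieldType.

(** The polynomial in the shift with coefficients [c]; its kernel is the set of solutions of the
    recurrence [c]. *)
Definition shift_comb (n : nat) (c : 'rV[F]_n) (a : sequences F) :
    sequences F :=
  fun k => \sum_(i < n) c 0 i * a (i + k)%N.

Lemma shift_comb_LCAT (n : nat) (c : 'rV[F]_n) : LCAT_set (shift_comb c).
Proof.
split; [split|].
- move=> a; apply: (@cvg_sequences _ _ _ (nbhs_filter a)) => k.
  have : \forall b \near a, forall i : 'I_n, b (i + k)%N = a (i + k)%N.
    by apply: (filter_forall (nbhs_filter a)) => i; exact: near_coord.
  apply: filterS => b ba; by apply: eq_bigr => i _; rewrite ba.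
- apply/funext => a; apply/funext => k; apply: eq_bigr => i _.
  by rewrite /shift addnS.
- move=> x a b; apply/funext => k.
  rewrite [RHS]/(x * shift_comb c a k + shift_comb c b k) /shift_comb mulr_sumr.
  rewrite -[RHS]big_split; apply: eq_bigr => i _ /=.
  rewrite [X in _ * X = _]/(x * a (i + k)%N + b (i + k)%N).
  by rewrite mulrDr mulrCA.
Qed.

Lemma recurrence_inj (n : nat) (c : 'rV[F]_n) (a b : sequences F) :
  c != 0 -> shift_comb c a = shift_comb c b ->
  (forall i, (i < n)%N -> a i = b i) -> a = b.
Proof.
move=> /rV0Pn [i0 ci0] eq_ab ab_lt.
(* The top coefficients of [c] may vanish, so the recurrence is solved for the term at its last
   nonzero coefficient, [c 0 j]. *)
case: (@arg_maxnP _ i0 (fun i => c 0 i != 0) val ci0) => j cj jmax.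
apply/funext => k; elim/ltn_ind: k => k IHk.
have [/ab_lt //|le_nk] := ltnP k n.
have le_jk : (j <= k)%N by rewrite (leq_trans (ltnW (ltn_ord j))).
(* At position [k - j], the term of index [j] involves [a k]. The other terms agree: those above [j]
   have coefficient zero, those below involve earlier entries. *)
have /(congr1 (fun s => s (k - j)%N)) := eq_ab.
rewrite /shift_comb (bigD1 j) //= [RHS](bigD1 j) //= subnKC //.
rewrite [X in _ + X](_ : _ = \sum_(i < n | i != j) c 0 i * b (i + (k - j))%N).
  by move/addIr/(mulfI cj).
apply: eq_bigr => i neq_ij.
have [->|ci] := eqVneq (c 0 i) 0; first by rewrite !mul0r.
rewrite IHk //.
have lt_ij : (i < j)%N by rewrite ltn_neqAle neq_ij; exact: jmax.
by rewrite -[X in (_ < X)%N](subnKC le_jk) ltn_add2r.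
Qed.

Lemma finite_recurrent (n : nat) :
  finite_set [set a : sequences F | exists2 c : 'rV[F]_n,
    c != 0 & shift_comb c a = fun=> 0].
Proof.
apply: (@sub_finite_set _ _ (\bigcup_(c in [set c : 'rV[F]_n | c != 0])
    [set a | shift_comb c a = fun=> 0])).
  by move=> a [c c0 ca]; exists c.
apply: bigcup_finite => [|c /= c0]; first exact: finite_finset.
pose prefix (a : sequences F) : 'rV[F]_n := \row_(i < n) (a i : F).
have prefix_inj : {in [set a | shift_comb c a = fun=> 0] &, injective prefix}.
  move=> a b /set_mem /= ca /set_mem /= cb /rowP ab.
  apply: (recurrence_inj c0) => [|i lt_in]; first by rewrite ca cb.
  by have := ab (Ordinal lt_in); rewrite !mxE.
have /card_eqPle[_ le_image] := inj_card_eq prefix_inj.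
exact: card_le_finite le_image finite_finset.
Qed.

Lemma prefix_surj (n : nat) (a b : sequences F) :
  (forall c : 'rV[F]_n, shift_comb c a = (fun=> 0) -> c = 0) ->
  exists (N : nat) (d : 'rV[F]_N),
    forall k, (k < n)%N -> shift_comb d a k = b k.
Proof.
move=> norec.
(* [h c] is a position where the recurrence [c] fails, with an arbitrary value for [c = 0]. *)
have /choice [h hP] : forall c : 'rV[F]_n,
    exists k, c != 0 -> shift_comb c a k != 0.
  move=> c; have [->|c0] := eqVneq c 0; first by exists 0%N.
  apply: contrapT => /forallNP h; move/eqP: c0; apply; apply: norec.
  apply/funext => k; apply/eqP; apply: contraT => ck.
  by case: (h k).
(* There are finitely many [c], so [N] columns witness the failure of every nonzero recurrence. *)
pose N := (\max_c h c).+1.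
pose H : 'M[F]_(n, N) := \matrix_(j, i) a (j + i)%N.
have freeH : row_free H.
  apply: inj_row_free => c cH; apply/eqP; apply: contraT => c0.
  have lt_hN : (h c < N)%N by rewrite ltnS leq_bigmax.
  have /rowP/(_ (Ordinal lt_hN)) := cH; rewrite !mxE /=.
  under eq_bigr => i _ do rewrite mxE /=.
  by move=> /eqP; rewrite (negPf (hP c c0)).
(* Row [i] of [H^T] is the prefix of the [i]-th shift of [a], so solving for [b] in its row space
   yields the coefficients [d]. *)
have fullHT : row_full H^T by rewrite /row_full mxrank_tr.
have /submxP [d dP] := submx_full (\row_(k < n) (b k : F)) fullHT.
exists N, d => k lt_kn.
have /rowP/(_ (Ordinal lt_kn)) := dP; rewrite !mxE /= => ->.
by apply: eq_bigr => i _; rewrite !mxE addnC.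
Qed.

End ShiftCombinations.

Theorem theorem3p1 (p m : nat) (F : finFieldType)
    (p_prime : prime p) (m_ge1 : (1 <= m)%N) (cardF : #|F| = (p ^ m)%N) :
  is_ID (LCAT F).
Proof.
move=> A clA invA [_ properA]; apply: contrapT => infA; apply: properA.
move=> b _; apply: closed_prefix => // n.
have [a Aa norec] : exists2 a, A a &
    forall c : 'rV[F]_n, shift_comb c a = (fun=> 0) -> c = 0.
  (* Otherwise [A] lies in the finite set of [finite_recurrent]. *)
  apply: contrapT => allrec; apply: infA.
  apply: sub_finite_set (@finite_recurrent F n) => a Aa.
  apply: contrapT => norec; apply: allrec; exists a => // c ca.
  by apply/eqP; apply: contraT => c0; case: norec; exists c.
have [N [d db]] := prefix_surj b norec.
exists (shift_comb d a) => //; apply: invA (shift_comb_LCAT d) _ _.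
by exists a.
Qed.
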